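(* Let $(M,\varphi,\xi,\eta,g)$ be a $3$-dimensional $\mathcal F_1$-manifold and let $C(t)$ be a non-geodesic slant null curve on $M$ with $\eta(\dot C)=a$ (a real constant) and $b=g(\dot C,\varphi\dot C)$. Then, among the general Frenet frames along $C(t)$ having the same orientation as the basis $\{\dot C,\xi,\varphi\dot C\}$, there exists a unique Frenet frame $\mathbf F_1=\{\dot C,N_1,W_1\}$ for which the original parameter $t$ is distinguished, and $$W_1=\alpha\xi-\frac{\alpha}{a}\dot C+\gamma\varphi\dot C,\qquad N_1=\frac1a\xi-\frac1{2a^2}\dot C,$$ where $\alpha=-\dfrac{b}{\sqrt{a^4+b^2}}$ and $\gamma=\dfrac{a}{\sqrt{a^4+b^2}}$.
   Context: A $3$-dimensional almost contact B-metric manifold $(M,\varphi,\xi,\eta,g)$ is a $3$-dimensional smooth manifold $M$ with an endomorphism field $\varphi$ of $TM$, a vector field $\xi$ (Reeb vector field), a $1$-form $\eta$ and a pseudo-Riemannian metric $g$ such that $\varphi^2=-\mathrm{id}+\eta\otimes\xi$, $\eta(\xi)=1$ and $g(\varphi X,\varphi Y)=-g(X,Y)+\eta(X)\eta(Y)$. Consequently $\eta\circ\varphi=0$, $\varphi\xi=0$, $\eta(X)=g(X,\xi)$, $g(\xi,\xi)=1$, and $g$ has signature $(2,1)$. $\nabla$ is the Levi-Civita connection of $g$, $F(X,Y,Z)=g((\nabla_X\varphi)Y,Z)$, and the Lee form is $\theta(X)=\sum_{i,j=1}^{2}g^{ij}F(e_i,e_j,X)$, where $\{e_1,e_2,\xi\}$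 is a basis of $T_xM$ with $e_1,e_2\in\ker\eta$ and $(g^{ij})$ is the inverse of $(g(e_i,e_j))$. $(M,\varphi,\xi,\eta,g)$ is an $\mathcal F_1$-manifold if $$F(X,Y,Z)=\tfrac12\{g(X,\varphi Y)\theta(\varphi Z)+g(\varphi X,\varphi Y)\theta(\varphi^2Z)+g(X,\varphi Z)\theta(\varphi Y)+g(\varphi X,\varphi Z)\theta(\varphi^2Y)\}.$$ (On such a manifold $\nabla\xi=0$.) A null curve is a smooth curve $C(t)$ with $\dot C\ne0$ and $g(\dot C,\dot C)=0$ everywhere. It is slant if $g(\dot C,\xi)=\eta(\dot C)=a$ is a real constant. A general Frenet frame along a null curve $C$ is a frame $\mathbf F=\{\dot C,N,W\}$ of vector fields along $C$ with $g(\dot C,N)=g(W,W)=1$ and $g(N,N)=g(N,W)=g(\dot C,W)=0$; the functions $h,k_1,k_2$ with respect to $\mathbf F$ are defined by $\nabla_{\dot C}\dot C=h\dot C+k_1W$, $\nabla_{\dot C}N=-hN+k_2W$, $\nabla_{\dot C}W=-k_2\dot C-k_1N$. The parameter $t$ is distinguished for $\mathbf F$ if $h$ vanishes identically. The curve is called non-geodesic if $k_1$ is nowhere zero (this does not depend on the choice of general Frenet frame). For every null curve $\{\dot C,\xi,\varphi\dot C\}$ is a basis of $T_xM$ at each $x\in C$. *)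

(* Defs.v *)
From HB Require Import structures.
From mathcomp Require Import all_boot all_order all_algebra.
From mathcomp Require Import all_classical all_reals all_analysis.
Set Implicit Arguments. Unset Strict Implicit. Unset Printing Implicit Defensive.
Import Order.TTheory GRing.Theory Num.Theory.
Import numFieldNormedType.Exports.
Local Open Scope classical_set_scope.
Local Open Scope ring_scope.

(* Only meaningful for open U (the derivatives are not taken "within" U). *)
Fixpoint times_differentiable {R : realType} {V W : normedModType R}
    (k : nat) (U : set V) (f : V -> W) : Prop :=
  match k with
  | 0%N => True
  | k'.+1 => (forall x, U x -> differentiable f x) /\
             (forall v, times_differentiable k' U (fun x => 'D_v f x))
  end.

Definition smooth_on {R : realType} {V W : normedModType R}
    (U : set V) (f : V -> W) : Prop := forall k, times_differentiable k U f.

(* A smooth atlas of dimension 3.  The maps chart i and param i are total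
   functions; only their values on dom i and chart i @` dom i matter. *)
Record atlas (R : realType) (M : topologicalType) := Atlas {
  chart_index : Type ;
  dom : chart_index -> set M ;
  chart : chart_index -> M -> 'rV[R]_3 ;
  param : chart_index -> 'rV[R]_3 -> M ;
  dom_open : forall i, open (dom i) ;
  dom_cover : forall p : M, exists i, dom i p ;
  codom_open : forall i, open (chart i @` dom i) ;
  chartK : forall i p, dom i p -> param i (chart i p) = p ;
  chart_continuous : forall i p, dom i p -> {for p, continuous (chart i)} ;
  param_continuous : forall i y, (chart i @` dom i) y ->
    {for y, continuous (param i)} ;
  transition_smooth : forall i j,
    smooth_on (chart i @` (dom i `&` dom j)) (chart j \o param i)
}.

Section TensorFields.
Context {R : realType} {M : topologicalType} (A : atlas R M).

Definition smooth_in {V : normedModType R} (i : chart_index A) (f : M -> V) : Prop :=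
  smooth_on (chart i @` dom i) (f \o param i).

(* The partial derivative of f with respect to the k-th coordinate of chart i. *)
Definition pd {V : normedModType R} (i : chart_index A) (k : 'I_3) (f : M -> V) (p : M) : V :=
  'D_(delta_mx 0 k : 'rV[R]_3) (f \o param i) (chart i p).

(* The (k, l) entry is the k-th partial derivative of the l-th new coordinate. *)
Definition jac (i j : chart_index A) (p : M) : 'M[R]_3 :=
  jacobian (chart j \o param i) (chart i p).

(* Tensor fields are families of components, one for each chart, related by the
   tensorial transformation laws.  Tangent vectors are row vectors, covectors
   are column vectors, an endomorphism P is the map X |-> X *m P, and a
   bilinear form G is the map (X, Y) |-> X *m G *m Y^T. *)
Definition ev (X : 'rV[R]_3) (w : 'cV[R]_3) : R := (X *m w) 0 0.
Definition ip (G : 'M[R]_3) (X Y : 'rV[R]_3) : R := (X *m G *m Y^T) 0 0.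

Definition vector_field (X : chart_index A -> M -> 'rV[R]_3) : Prop :=
  (forall i, smooth_in i (X i)) /\
  (forall i j p, dom i p -> dom j p -> X j p = X i p *m jac i j p).

Definition one_form (w : chart_index A -> M -> 'cV[R]_3) : Prop :=
  (forall i, smooth_in i (w i)) /\
  (forall i j p, dom i p -> dom j p -> w i p = jac i j p *m w j p).

Definition endomorphism_field (P : chart_index A -> M -> 'M[R]_3) : Prop :=
  (forall i, smooth_in i (P i)) /\
  (forall i j p, dom i p -> dom j p -> P i p *m jac i j p = jac i j p *m P j p).

Definition pseudo_riemannian_metric (g : chart_index A -> M -> 'M[R]_3) : Prop :=
  [/\ forall i, smooth_in i (g i),
      forall i j p, dom i p -> dom j p -> g i p = jac i j p *m g j p *m (jac i j p)^T,
      forall i p, dom i p -> (g i p)^T = g i p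
    & forall i p, dom i p -> g i p \in unitmx].

(* Affine connections: the (b, c) entry of G i a p is the coefficient of the
   c-th coordinate field in the covariant derivative of the b-th coordinate
   field along the a-th one, so that nabla_a Y = pd i a Y + Y *m G i a p. *)
Definition affine_connection (G : chart_index A -> 'I_3 -> M -> 'M[R]_3) : Prop :=
  (forall i a, smooth_in i (G i a)) /\
  (forall i j p, dom i p -> dom j p -> forall a,
    G i a p *m jac i j p =
    pd i a (jac i j) p + jac i j p *m (\sum_(b < 3) jac i j p a b *: G j b p)).

Definition torsion_free (G : chart_index A -> 'I_3 -> M -> 'M[R]_3) : Prop :=
  forall i p, dom i p -> forall a b c, G i a p b c = G i b p a c.

Definition metric_connection (g : chart_index A -> M -> 'M[R]_3)
    (G : chart_index A -> 'I_3 -> M -> 'M[R]_3) : Prop :=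
  forall i p, dom i p -> forall a,
    pd i a (g i) p = G i a p *m g i p + g i p *m (G i a p)^T.

Definition levi_civita (g : chart_index A -> M -> 'M[R]_3)
    (G : chart_index A -> 'I_3 -> M -> 'M[R]_3) : Prop :=
  [/\ affine_connection G, torsion_free G & metric_connection g G].

Definition frame_mx (X Y Z : 'rV[R]_3) : 'M[R]_3 :=
  \matrix_(k < 3) [:: X; Y; Z]`_k.

Definition same_orientation (B B' : 'M[R]_3) : Prop :=
  exists P : 'M[R]_3, B = P *m B' /\ 0 < \det P.

End TensorFields.

Record almost_contact_Bmetric (R : realType) (M : topologicalType) (A : atlas R M) :=
  AlmostContactBmetric {
  phi : chart_index A -> M -> 'M[R]_3 ;
  xi : chart_index A -> M -> 'rV[R]_3 ;
  eta : chart_index A -> M -> 'cV[R]_3 ;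
  g : chart_index A -> M -> 'M[R]_3 ;
  phi_endo : endomorphism_field phi ;
  xi_vector : vector_field xi ;
  eta_form : one_form eta ;
  g_metric : pseudo_riemannian_metric g ;
  phi_square : forall i p, dom i p -> forall X : 'rV[R]_3,
    X *m phi i p *m phi i p = - X + ev X (eta i p) *: xi i p ;
  eta_xi : forall i p, dom i p -> ev (xi i p) (eta i p) = 1 ;
  g_phi : forall i p, dom i p -> forall X Y : 'rV[R]_3,
    ip (g i p) (X *m phi i p) (Y *m phi i p) =
    - ip (g i p) X Y + ev X (eta i p) * ev Y (eta i p)
}.

Section AlmostContact.
Context {R : realType} {M : topologicalType} {A : atlas R M}.
Variables (S : almost_contact_Bmetric A) (G : chart_index A -> 'I_3 -> M -> 'M[R]_3).

(* From (nabla_a phi) Y = nabla_a (phi Y) - phi (nabla_a Y). *)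
Definition nabla_phi (i : chart_index A) (p : M) (X : 'rV[R]_3) : 'M[R]_3 :=
  \sum_(a < 3) X 0 a *:
    (pd i a (phi S i) p + phi S i p *m G i a p - G i a p *m phi S i p).

Definition fundamental_tensor (i : chart_index A) (p : M) (X Y Z : 'rV[R]_3) : R :=
  ip (g S i p) (Y *m nabla_phi i p X) Z.

Definition adapted_basis (i : chart_index A) (p : M) (e : 'I_2 -> 'rV[R]_3) : Prop :=
  (forall a, ev (e a) (eta S i p) = 0) /\
  frame_mx (e 0) (e 1) (xi S i p) \in unitmx.

Definition lee_form (i : chart_index A) (p : M) (e : 'I_2 -> 'rV[R]_3) (X : 'rV[R]_3) : R :=
  \sum_(a < 2) \sum_(b < 2)
    (invmx (\matrix_(c, d) ip (g S i p) (e c) (e d)) : 'M[R]_2) a b *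
    fundamental_tensor i p (e a) (e b) X.

(* The value of lee_form is the same for all adapted bases e. *)
Definition F1_manifold : Prop :=
  forall i p, dom i p -> forall e, adapted_basis i p e ->
  let gp := ip (g S i p) in
  let f (X : 'rV[R]_3) := X *m phi S i p in
  let theta := lee_form i p e in
  forall X Y Z : 'rV[R]_3,
    fundamental_tensor i p X Y Z =
    2^-1 * (gp X (f Y) * theta (f Z) + gp (f X) (f Y) * theta (f (f Z)) +
            gp X (f Z) * theta (f Y) + gp (f X) (f Z) * theta (f (f Y))).

End AlmostContact.

Section Curves.
Context {R : realType} {M : topologicalType} {A : atlas R M}.
Variables (S : almost_contact_Bmetric A) (G : chart_index A -> 'I_3 -> M -> 'M[R]_3).
Variables (J : set R) (C : R -> M).

Definition open_interval : Prop := [/\ J !=set0, open J & is_interval J].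

Definition curve_dom (i : chart_index A) : set R := J `&` C @^-1` dom i.

Definition smooth_curve : Prop :=
  (forall t, J t -> {for t, continuous C}) /\
  (forall i : chart_index A, smooth_on (curve_dom i) (chart i \o C)).

Definition velocity (i : chart_index A) (t : R) : 'rV[R]_3 := derive1 (chart i \o C) t.

Definition field_along (V : chart_index A -> R -> 'rV[R]_3) : Prop :=
  (forall i, smooth_on (curve_dom i) (V i)) /\
  (forall i j t, curve_dom i t -> curve_dom j t -> V j t = V i t *m jac i j (C t)).

Definition eq_along (V V' : chart_index A -> R -> 'rV[R]_3) : Prop :=
  forall i t, curve_dom i t -> V i t = V' i t.

Definition cov_deriv (V : chart_index A -> R -> 'rV[R]_3) (i : chart_index A) (t : R) : 'rV[R]_3 :=
  derive1 (V i) t + V i t *m (\sum_(a < 3) velocity i t 0 a *: G i a (C t)).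

Definition null_curve : Prop :=
  smooth_curve /\
  forall i t, curve_dom i t ->
    velocity i t != 0 /\ ip (g S i (C t)) (velocity i t) (velocity i t) = 0.

Definition slant (a : R) : Prop :=
  forall i t, curve_dom i t -> ev (velocity i t) (eta S i (C t)) = a.

Definition general_frenet_frame (N W : chart_index A -> R -> 'rV[R]_3) : Prop :=
  [/\ field_along N, field_along W &
    forall i t, curve_dom i t ->
    let gt := ip (g S i (C t)) in
    frame_mx (velocity i t) (N i t) (W i t) \in unitmx /\
    [/\ gt (velocity i t) (N i t) = 1, gt (W i t) (W i t) = 1,
        gt (N i t) (N i t) = 0, gt (N i t) (W i t) = 0 &
        gt (velocity i t) (W i t) = 0]].

Definition frenet_equations (N W : chart_index A -> R -> 'rV[R]_3) (h k1 k2 : R -> R) : Prop :=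
  forall i t, curve_dom i t ->
  [/\ cov_deriv velocity i t = h t *: velocity i t + k1 t *: W i t,
      cov_deriv N i t = - h t *: N i t + k2 t *: W i t &
      cov_deriv W i t = - k2 t *: velocity i t - k1 t *: N i t].

(* The functions h, k1, k2 of a general Frenet frame exist and are unique. *)
Definition distinguished (N W : chart_index A -> R -> 'rV[R]_3) : Prop :=
  exists h k1 k2, frenet_equations N W h k1 k2 /\ (forall t, J t -> h t = 0).

(* The condition on k1 does not depend on the choice of the frame. *)
Definition non_geodesic : Prop :=
  exists N W h k1 k2, [/\ general_frenet_frame N W, frenet_equations N W h k1 k2 &
    forall t, J t -> k1 t != 0].

Definition xi_oriented (N W : chart_index A -> R -> 'rV[R]_3) : Prop :=
  forall i t, curve_dom i t ->
    same_orientation (frame_mx (velocity i t) (N i t) (W i t))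
      (frame_mx (velocity i t) (xi S i (C t)) (velocity i t *m phi S i (C t))).

End Curves.

(* Main.v *)
Require Import Defs.
From HB Require Import structures.
From mathcomp Require Import all_boot all_order all_algebra.
From mathcomp Require Import all_classical all_reals all_analysis.
From mathcomp Require Import ring lra.
Set Implicit Arguments. Unset Strict Implicit. Unset Printing Implicit Defensive.
Import Order.TTheory GRing.Theory Num.Theory.
Import numFieldNormedType.Exports.
Local Open Scope classical_set_scope.
Local Open Scope ring_scope.

(** The theorem rests on the fact that [xi] is parallel along the curve
    (lemma [xi_parallel]): the defining identity of the class F1 gives
    [(nabla_V phi) xi = 0] for the velocity [V], and differentiating
    [phi xi = 0] and [g (xi, xi) = 1] then yields [nabla_V xi = 0].

    For a slant null curve the products [g (V, V) = 0] and [g (V, xi) = a] are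
    constant, so the acceleration [nabla_V V] is orthogonal to [V] and to [xi].
    Non-geodesicity then excludes [a = 0] (lemma [slant_const_neq0]): otherwise
    [xi] would be proportional to [V].  For [a != 0] the combination
    [N1 = xi / a - V / (2 a^2)] is null with [g (V, N1) = 1], and the given [W1]
    is a unit vector orthogonal to [V] and [N1] (lemma [slant_null_frame]); it is
    well defined because [a^4 + b^2] is minus the Gram determinant of
    [V], [xi], [phi V], which is nonzero (lemma [null_gt0]).  The acceleration is
    orthogonal to [V] and [N1], hence a multiple of [W1]: the parameter is
    distinguished for this frame (lemma [acc_binormal]), and the remaining Frenet
    equations follow from metric compatibility (lemma
    [curve_frenet_equations]).

    Conversely, in any frame for which the parameter is distinguished, [W] is
    proportional to the nonzero acceleration, hence [W = W1] or [W = - W1], and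
    [N] is determined by its products with [V], [W] and itself.  The orientation
    selects the sign (lemma [frenet_unique]).

    Frame fields have to be smooth and to transform as vector fields between
    charts.  Smoothness is closed under sums, products, compositions with the
    curve and inverse square roots of positive functions, all proved by
    induction on the order of differentiability. *)

(** * Calculus of iterated differentiability *)

Section Calculus.
Context {R : realType}.
Implicit Types V W : normedModType R.
Notation td := times_differentiable.

(** Differentiability depends only on the germ of the function: an equality
    on a neighbourhood changes neither the affine part nor the remainder. *)
Lemma differentiable_near V W (f g : V -> W) x :
  (\forall y \near x, f y = g y) -> differentiable f x -> differentiable g x.
Proof.
move=> fg df.
have fgx : f x = g x by exact: nbhs_singleton fg.
have E : g \o shift x = cst (g x) + 'd f x +o_ 0 id.
  apply/eqaddoE/eqaddoP => e e0.
  have /eqaddoP/(_ e e0) := diff_locally df.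
  have : \forall h \near (0 : V), f (h + x) = g (h + x).
    by move: fg; rewrite (near_shift 0); apply: filterS => h /=; rewrite subr0.
  by move=> H1; apply: filterS2 H1 => h /= E; rewrite -fgx; move: E; rewrite !fctE /= => ->.
have dE := diff_unique (diff_continuous df) E.
by apply/diff_locallyP; rewrite dE; split => //; exact: diff_continuous.
Qed.

Lemma differentiable_mxP V m n (M : V -> 'M[R]_(m, n)) x :
  differentiable M x <-> forall i j, differentiable (fun y => M y i j) x.
Proof.
split=> [dM i j|dM].
  apply: (@differentiable_comp _ _ _ _ M (fun N => N i j)) => //.
  exact: differentiable_coord.
have -> : M = \sum_(i < m) \sum_(j < n) (fun y => M y i j *: delta_mx i j).
  apply/funext => y; rewrite fct_sumE [LHS]matrix_sum_delta.
  by apply: eq_bigr => i _; rewrite fct_sumE.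
by apply: differentiable_sum => i; apply: differentiable_sum => j; exact: differentiableZl.
Qed.

Lemma derive_entry V m n (M : V -> 'M[R]_(m, n)) x v i j :
  differentiable M x -> ('D_v M x) i j = 'D_v (fun y => M y i j) x.
Proof. by move=> dM; rewrite derive_mx ?mxE //; exact: diff_derivable. Qed.

(** The product rule for the directional derivative of a matrix product, read
    off from its entries, which are sums of products of scalar functions. *)
Lemma derive_mulmx V m n p (M : V -> 'M[R]_(m, n)) (N : V -> 'M[R]_(n, p)) x v :
  differentiable M x -> differentiable N x ->
  differentiable (fun y => M y *m N y) x /\
  'D_v (fun y => M y *m N y) x = 'D_v M x *m N x + M x *m 'D_v N x.
Proof.
move=> dM dN.
have dMe := (differentiable_mxP M x).1 dM.
have dNe := (differentiable_mxP N x).1 dN.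
have E i j : (fun y => (M y *m N y) i j) =
    \sum_(k < n) ((fun y => M y i k) * (fun y => N y k j)).
  by apply/funext => y; rewrite mxE fct_sumE.
have dE : differentiable (fun y => M y *m N y) x.
  apply/differentiable_mxP => i j; rewrite E.
  by apply: differentiable_sum => k; exact: differentiableM.
split=> //; apply/matrixP => i j.
rewrite derive_entry // E derive_sum; last first.
  by move=> k; apply: diff_derivable; exact: differentiableM.
rewrite !mxE -big_split; apply: eq_bigr => k _ /=.
rewrite deriveM; try exact: diff_derivable.
rewrite (derive_entry v i k dM) (derive_entry v k j dN) addrC.
by congr (_ + _); exact: mulrC.
Qed.

Lemma derive_trmx V m n (M : V -> 'M[R]_(m, n)) x v : differentiable M x ->
  differentiable (fun y => (M y)^T) x /\ 'D_v (fun y => (M y)^T) x = ('D_v M x)^T.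
Proof.
move=> dM; have dT : differentiable (fun y => (M y)^T) x.
  apply/differentiable_mxP => i j.
  have -> : (fun y => (M y)^T i j) = (fun y => M y j i).
    by apply/funext => y; rewrite mxE.
  exact: (differentiable_mxP M x).1.
split=> //; apply/matrixP => i j; rewrite mxE !derive_entry //.
by congr ('D_v _ x); apply/funext => y; rewrite mxE.
Qed.

Lemma td_lower V W k (U : set V) (f : V -> W) : td k.+1 U f -> td k U f.
Proof. by elim: k f => //= k IH f [df Df]; split=> // v; apply: IH; exact: Df. Qed.

(** On an open set the iterated derivatives only see the values taken there,
    so formulas that hold on a chart domain alone can be substituted. *)
Lemma td_ext V W k (U : set V) (f f' : V -> W) : open U ->
  (forall x, U x -> f x = f' x) -> td k U f -> td k U f'.
Proof.
move=> oU; elim: k f f' => //= k IH f f' ff' [df Df].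
have near_ff' x : U x -> \forall y \near x, f y = f' y.
  by move=> Ux; apply: filterS (open_nbhs_nbhs (conj oU Ux)).
split=> [x Ux|v]; first exact: differentiable_near (near_ff' x Ux) (df x Ux).
by apply: IH (Df v) => x Ux; apply: near_eq_derive; exact: near_ff'.
Qed.

(** Smoothness of matrix-valued maps reduces to that of their entries; this is
    what turns every closure property below into one about scalar functions. *)
Lemma td_mxP V m n k (U : set V) (M : V -> 'M[R]_(m, n)) : open U ->
  td k U M <-> forall i j, td k U (fun x => M x i j).
Proof.
move=> oU; elim: k M => [|k IH] M //=; split=> [[dM DM] i j|dM].
  split=> [x Ux|v]; first exact: (differentiable_mxP M x).1 (dM x Ux) i j.
  apply: td_ext ((IH _).1 (DM v) i j) => // x Ux.
  by rewrite derive_entry //; exact: dM.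
have dMx x : U x -> differentiable M x.
  by move=> Ux; apply/differentiable_mxP => i j; exact: (dM i j).1.
split=> // v; apply/IH => i j; apply: td_ext ((dM i j).2 v) => // x Ux.
by rewrite derive_entry //; exact: dMx.
Qed.

Lemma td_cst V W k (U : set V) (c : W) : td k U (fun=> c).
Proof.
elim: k c => //= k IH c; split=> [x _|v]; first exact: differentiable_cst.
have -> : (fun x : V => 'D_v (fun=> c) x) = (fun=> 0).
  by apply/funext => x; exact: derive_cst.
exact: IH.
Qed.

Lemma td_add V W k (U : set V) (f f' : V -> W) : open U ->
  td k U f -> td k U f' -> td k U (fun x => f x + f' x).
Proof.
move=> oU; elim: k f f' => //= k IH f f' [df Df] [df' Df'].
split=> [x Ux|v]; first by apply: differentiableD; [exact: df|exact: df'].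
apply: td_ext (IH _ _ (Df v) (Df' v)) => // x Ux.
by rewrite deriveD //; apply: diff_derivable; [exact: df|exact: df'].
Qed.

Lemma td_sum V W k (U : set V) n (f : 'I_n -> V -> W) : open U ->
  (forall i, td k U (f i)) -> td k U (fun x => \sum_(i < n) f i x).
Proof.
move=> oU; elim: n f => [|n IH] f df.
  by apply: td_ext (td_cst k U 0) => // x _; rewrite big_ord0.
apply: td_ext (td_add oU (IH (fun i => f (widen_ord (leqnSn n) i)) _) (df ord_max)) => //.
by move=> x _; rewrite big_ord_recr.
Qed.

Lemma td_mul V k (U : set V) (f f' : V -> R) : open U ->
  td k U f -> td k U f' -> td k U (fun x => f x * f' x).
Proof.
move=> oU; elim: k f f' => // k IH f f' df df'.
have [/= dfx Df] := df; have [/= df'x Df'] := df'; split=> [x Ux|v].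
  by apply: differentiableM; [exact: dfx|exact: df'x].
have dD := td_add oU (IH _ _ (td_lower df) (Df' v)) (IH _ _ (td_lower df') (Df v)).
apply: td_ext dD => // x Ux.
by rewrite deriveM //; apply: diff_derivable; [exact: dfx|exact: df'x].
Qed.

Lemma td_scale V m n k (U : set V) (f : V -> R) (M : V -> 'M[R]_(m, n)) : open U ->
  td k U f -> td k U M -> td k U (fun x => f x *: M x).
Proof.
move=> oU df dM; apply/(td_mxP _ _ oU) => i j.
apply: td_ext (td_mul oU df ((td_mxP _ _ oU).1 dM i j)) => // x _.
by rewrite mxE.
Qed.

Lemma td_mulmx V m n p k (U : set V) (M : V -> 'M[R]_(m, n)) (N : V -> 'M[R]_(n, p)) :
  open U -> td k U M -> td k U N -> td k U (fun x => M x *m N x).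
Proof.
move=> oU dM dN; apply/(td_mxP _ _ oU) => i j.
apply: (@td_ext _ _ _ _ (fun x => \sum_l M x i l * N x l j)) => //.
  by move=> x _; rewrite mxE.
apply: td_sum => // l; apply: td_mul => //.
- exact: ((td_mxP _ _ oU).1 dM).
- exact: ((td_mxP _ _ oU).1 dN).
Qed.

Lemma td_trmx V m n k (U : set V) (M : V -> 'M[R]_(m, n)) :
  open U -> td k U M -> td k U (fun x => (M x)^T).
Proof.
move=> oU dM; apply/(td_mxP _ _ oU) => i j.
by apply: td_ext ((td_mxP _ _ oU).1 dM j i) => // x _; rewrite mxE.
Qed.

Lemma derive_comp_rV V W n (c : V -> 'rV[R]_n) (f : 'rV[R]_n -> W) x v :
  differentiable c x -> differentiable f (c x) ->
  differentiable (f \o c) x /\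
  'D_v (f \o c) x = \sum_(j < n) ('D_v c x) 0 j *: 'D_(delta_mx 0 j) f (c x).
Proof.
move=> dc df; have dfc := differentiable_comp dc df; split=> //.
rewrite (deriveE _ dfc) diff_comp //= -(deriveE v dc).
rewrite [in LHS](row_sum_delta ('D_v c x)) linear_sum.
have Z j : 'd f (c x) (('D_v c x) 0 j *: delta_mx 0 j) =
    ('D_v c x) 0 j *: 'D_(delta_mx 0 j) f (c x).
  by rewrite (deriveE _ df) -linearZ.
by rewrite (eq_bigr _ (fun j _ => Z j)).
Qed.

(** Composition, by induction on the order: the chain rule writes the first
    derivative as a sum of products of derivatives of [c] and of compositions
    of [c] with the partial derivatives of [f], all covered at the lower order. *)
Lemma td_comp V m n q k (U : set V) (O : set 'rV[R]_q) (c : V -> 'rV[R]_q)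
    (f : 'rV[R]_q -> 'M[R]_(m, n)) :
  open U -> (forall x, U x -> O (c x)) -> td k U c -> td k O f -> td k U (f \o c).
Proof.
move=> oU cO; elim: k f => // k IH f dc df.
have [/= dcx Dc] := dc; have [/= dfx Df] := df; split=> [x Ux|v].
  by apply: differentiable_comp; [exact: dcx|exact/dfx/cO].
apply: (@td_ext _ _ _ _
  (fun x => \sum_(j < q) ('D_v c x) 0 j *: 'D_(delta_mx 0 j) f (c x))) => //.
  by move=> x Ux; rewrite (derive_comp_rV _ (dcx _ Ux) (dfx _ (cO _ Ux))).2.
apply: td_sum => // j; apply: td_scale => //.
  exact: ((td_mxP _ _ oU).1 (Dc v)).
exact: (IH _ (td_lower dc) (Df _)).
Qed.

Lemma derive_inv_sqrt (V : normedModType R) (u : V -> R) x v :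
  differentiable u x -> 0 < u x ->
  let r := fun y => (Num.sqrt (u y))^-1 in
  differentiable r x /\ 'D_v r x = - 2^-1 * (r x * r x * r x) * 'D_v u x.
Proof.
move=> du u0 r.
have s0 : Num.sqrt (u x) != 0 by rewrite gt_eqF // sqrtr_gt0.
have [sd sD] := is_derive1_sqrt u0.
have ds : differentiable (@Num.sqrt R) (u x) by apply/derivable1_diffP.
have dsu : differentiable (Num.sqrt \o u) x by exact: differentiable_comp.
split; first by apply: (@differentiableV _ _ (Num.sqrt \o u)).
have := deriveV (s0 : (Num.sqrt \o u) x != 0) (diff_derivable (v:=v) dsu).
rewrite -[LHS]/('D_v r x) => ->.
rewrite /= (deriveE v dsu) diff_comp //= diff1E // -(deriveE v du) derive1E sD.
by rewrite /r /GRing.scale /=; field.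
Qed.

(** The function [r = u ^ (-1/2)] solves [r' = - r^3 u' / 2], so its
    regularity improves by one order at each step, up to that of [u]. *)
Lemma td_inv_sqrt (V : normedModType R) k (U : set V) (u : V -> R) : open U ->
  (forall x, U x -> 0 < u x) -> td k U u -> td k U (fun x => (Num.sqrt (u x))^-1).
Proof.
move=> oU u0; elim: k => // k IH du.
have [/= dux Du] := du; split=> [x Ux|v].
  by have [] := derive_inv_sqrt 0 (dux x Ux) (u0 x Ux).
have dr := IH (td_lower du).
pose r x := (Num.sqrt (u x))^-1.
apply: (@td_ext _ _ _ _ (fun x => - 2^-1 * (r x * r x * r x) * 'D_v u x)) => //.
  by move=> x Ux; have [_ ->] := derive_inv_sqrt v (dux x Ux) (u0 x Ux).
apply: td_mul (Du v) => //.
apply: td_mul; [done|exact: td_cst|].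
by apply: td_mul => //; exact: td_mul.
Qed.

End Calculus.

(** * Linear algebra of an almost contact B-metric structure at a point *)

Section Pointwise.
Context {R : realType}.
Implicit Types (X Y Z V N W : 'rV[R]_3) (G : 'M[R]_3).

Lemma addrr0_eq0 (x : R) : x + x = 0 -> x = 0. Proof. lra. Qed.

Lemma ipDl G X Y Z : ip G (X + Y) Z = ip G X Z + ip G Y Z.
Proof. by rewrite /ip !mulmxDl mxE. Qed.
Lemma ipDr G X Y Z : ip G X (Y + Z) = ip G X Y + ip G X Z.
Proof. by rewrite /ip linearD mulmxDr mxE. Qed.
Lemma ipZl G k X Y : ip G (k *: X) Y = k * ip G X Y.
Proof. by rewrite /ip -!scalemxAl mxE. Qed.
Lemma ipZr G k X Y : ip G X (k *: Y) = k * ip G X Y.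
Proof. by rewrite /ip linearZ -scalemxAr mxE. Qed.
Lemma ipNl G X Y : ip G (- X) Y = - ip G X Y.
Proof. by rewrite -scaleN1r ipZl mulN1r. Qed.
Lemma ipNr G X Y : ip G X (- Y) = - ip G X Y.
Proof. by rewrite -scaleN1r ipZr mulN1r. Qed.
Lemma ip0l G Y : ip G 0 Y = 0.
Proof. by rewrite /ip !mul0mx mxE. Qed.
Lemma ip0r G X : ip G X 0 = 0.
Proof. by rewrite /ip linear0 mulmx0 mxE. Qed.
Definition ip_linear := (ipDl, ipDr, ipZl, ipZr, ipNl, ipNr, ip0l, ip0r).

Lemma ipC G X Y : G^T = G -> ip G X Y = ip G Y X.
Proof.
move=> sG; rewrite /ip -[in RHS](trmxK (Y *m G *m X^T)) [RHS]mxE.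
by rewrite !trmx_mul trmxK sG mulmxA.
Qed.

Lemma ip_nondegenerate G X : G \in unitmx -> (forall Y, ip G X Y = 0) -> X = 0.
Proof.
move=> uG X0; suff XG : X *m G = 0 by rewrite -(mulmxK uG X) XG mul0mx.
apply/rowP => j; rewrite [RHS]mxE; have := X0 (delta_mx 0 j).
by rewrite /ip trmx_delta -colE mxE.
Qed.

Lemma evD X Y (w : 'cV[R]_3) : ev (X + Y) w = ev X w + ev Y w.
Proof. by rewrite /ev mulmxDl mxE. Qed.
Lemma evZ k X (w : 'cV[R]_3) : ev (k *: X) w = k * ev X w.
Proof. by rewrite /ev -scalemxAl mxE. Qed.
Lemma evN X (w : 'cV[R]_3) : ev (- X) w = - ev X w.
Proof. by rewrite -scaleN1r evZ mulN1r. Qed.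

Definition row3 (x y z : R) : 'rV[R]_3 := \row_j [:: x; y; z]`_j.

Lemma mul_row_frame (u X Y Z : 'rV[R]_3) :
  u *m frame_mx X Y Z = u 0 0 *: X + u 0 1 *: Y + u 0 2%:R *: Z.
Proof.
apply/rowP => j; rewrite mxE !big_ord_recr big_ord0 /= add0r !mxE /=.
by congr (u 0 _ * _ + u 0 _ * _ + u 0 _ * _); apply/val_inj.
Qed.

Lemma frame_mul (X Y Z : 'rV[R]_3) G :
  frame_mx X Y Z *m G = frame_mx (X *m G) (Y *m G) (Z *m G).
Proof.
by apply/matrixP => k j; rewrite !mxE; case: k => -[|[|[|//]]] k3 /=;
  rewrite mxE; apply: eq_bigr => l _; rewrite !mxE.
Qed.

Lemma row3_frame x y z (X Y Z : 'rV[R]_3) :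
  row3 x y z *m frame_mx X Y Z = x *: X + y *: Y + z *: Z.
Proof. by rewrite mul_row_frame !mxE. Qed.

Lemma frame_unit (X Y Z : 'rV[R]_3) :
  (forall x y z, x *: X + y *: Y + z *: Z = 0 -> [/\ x = 0, y = 0 & z = 0]) ->
  frame_mx X Y Z \in unitmx.
Proof.
move=> indep; rewrite -row_free_unit; apply: inj_row_free => u.
rewrite mul_row_frame => /indep[u0 u1 u2]; apply/rowP => j; rewrite mxE.
by case: j => -[|[|[|//]]] j3; [rewrite -u0|rewrite -u1|rewrite -u2];
  congr (u 0 _); apply/val_inj.
Qed.

(** Testing a vector against one basis decides whether it vanishes. *)
Lemma ortho_frame G (D X Y Z : 'rV[R]_3) : G \in unitmx ->
  frame_mx X Y Z \in unitmx ->
  ip G D X = 0 -> ip G D Y = 0 -> ip G D Z = 0 -> D = 0.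
Proof.
move=> uG uF DX DY DZ; apply: (ip_nondegenerate uG) => T.
by rewrite -(mulmxKV uF T) mul_row_frame !ip_linear DX DY DZ !mulr0 !addr0.
Qed.

Lemma det_frame_row3 (x1 x2 x3 y2 y3 : R) :
  \det (frame_mx (row3 1 0 0) (row3 x1 x2 0) (row3 y2 y3 x3)) = x2 * x3.
Proof.
rewrite det_trig; last first.
  by apply/is_trig_mxP => -[[|[|[|//]]] i3] -[[|[|[|//]]] j3] //= _; rewrite !mxE.
by rewrite !big_ord_recr big_ord0 /= !mxE /= !mul1r.
Qed.

(** The relations of a general Frenet frame other than the nullity of [V],
    which is a property of the curve. *)
Definition null_frame G V N W : Prop :=
  [/\ ip G V N = 1, ip G W W = 1, ip G N N = 0, ip G N W = 0 & ip G V W = 0].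

(** The Gram matrix of the frame is a permutation matrix, so pairing a
    vanishing combination with [V], [N] and [W] returns its coefficients. *)
Lemma null_frame_unit G V N W : G^T = G -> ip G V V = 0 -> null_frame G V N W ->
  frame_mx V N W \in unitmx.
Proof.
move=> sG VV [VN WW NN NW VW]; apply: frame_unit => x y z E.
have EV : ip G (x *: V + y *: N + z *: W) V = 0 by rewrite E ip0l.
have EN : ip G (x *: V + y *: N + z *: W) N = 0 by rewrite E ip0l.
have EW : ip G (x *: V + y *: N + z *: W) W = 0 by rewrite E ip0l.
rewrite !ip_linear VV (ipC N V) // (ipC W V) // VN VW in EV.
rewrite !ip_linear NN (ipC W N) // VN NW in EN.
rewrite !ip_linear VW NW WW in EW.
by split; lra.
Qed.

(** In this frame the coefficient of [V] is the product with [N] and vice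
    versa, since the two null vectors are dual to each other. *)
Lemma null_frame_expand G V N W X : G^T = G -> G \in unitmx -> ip G V V = 0 ->
  null_frame G V N W ->
  X = ip G X N *: V + ip G X V *: N + ip G X W *: W.
Proof.
move=> sG uG VV F; have uF := null_frame_unit sG VV F.
case: F => VN WW NN NW VW.
apply/eqP; rewrite -subr_eq0; apply/eqP; apply: (ortho_frame uG uF);
  rewrite !ip_linear ?VV ?NN ?WW ?(ipC N V) // ?(ipC W V) // ?(ipC W N) //
    ?VN ?VW ?NW; lra.
Qed.

(** The algebraic identities of an almost contact B-metric structure at one
    point and in one chart, with [P], [x], [w], [G] the components of
    [phi], [xi], [eta], [g]. *)
Record contact_point (P : 'M[R]_3) (x : 'rV[R]_3) (w : 'cV[R]_3) (G : 'M[R]_3) : Prop :=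
  ContactPoint {
  cp_square : forall X, X *m P *m P = - X + ev X w *: x ;
  cp_eta_xi : ev x w = 1 ;
  cp_compat : forall X Y, ip G (X *m P) (Y *m P) = - ip G X Y + ev X w * ev Y w ;
  cp_sym : G^T = G ;
  cp_unit : G \in unitmx }.

Definition slant_normal (a : R) (x V : 'rV[R]_3) : 'rV[R]_3 :=
  a^-1 *: x - (2 * a ^+ 2)^-1 *: V.

Definition slant_binormal (a b : R) (x V Y : 'rV[R]_3) : 'rV[R]_3 :=
  let al := - (b / Num.sqrt (a ^+ 4 + b ^+ 2)) in
  al *: x - (al / a) *: V + (a / Num.sqrt (a ^+ 4 + b ^+ 2)) *: Y.

Section ContactPoint.
Variables (P : 'M[R]_3) (x : 'rV[R]_3) (w : 'cV[R]_3) (G : 'M[R]_3).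
Hypothesis H : contact_point P x w G.

(** Since [phi^2 xi = 0], the vector [phi xi] equals [c xi] with
    [c = eta (phi xi)], and applying [phi] once more gives [c^2 = 0]. *)
Lemma phi_xi : x *m P = 0.
Proof.
have x2 : x *m P *m P = 0 by rewrite (cp_square H) (cp_eta_xi H) scale1r addNr.
have := cp_square H (x *m P); rewrite x2 mul0mx; set c := ev _ w => E.
have xP : x *m P = c *: x by apply: (addrI (- (x *m P))); rewrite -E addNr.
have /eqP : c * c = 0.
  have := congr1 (fun z => ev z w) x2.
  by rewrite xP -scalemxAl xP !evZ (cp_eta_xi H) mulr1 [RHS]/ev mul0mx mxE.
by rewrite mulf_eq0 orbb => /eqP c0; rewrite xP c0 scale0r.
Qed.

(** Compare the two ways of computing [phi^3 X]. *)
Lemma eta_phi X : ev (X *m P) w = 0.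
Proof.
have E := cp_square H (X *m P).
rewrite (cp_square H X) mulmxDl mulNmx -scalemxAl phi_xi scaler0 addr0 in E.
have /eqP : ev (X *m P) w *: x = 0 by apply: (addrI (- (X *m P))); rewrite -E addr0.
move/eqP/(congr1 (fun z => ev z w)); rewrite evZ (cp_eta_xi H) mulr1 => ->.
by rewrite /ev mul0mx mxE.
Qed.

Lemma ip_xi X : ip G X x = ev X w.
Proof.
by have := cp_compat H X x; rewrite phi_xi ip0r (cp_eta_xi H) mulr1; lra.
Qed.

(** Apply the compatibility of [phi] and [g] to [phi X] and [Y].  The sign in
    the B-metric condition makes [phi] self-adjoint, not skew-adjoint. *)
Lemma ip_phi X Y : ip G (X *m P) Y = ip G X (Y *m P).
Proof.
have := cp_compat H (X *m P) Y; rewrite (cp_square H) eta_phi mul0r.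
by rewrite !ip_linear (ipC x _ (cp_sym H)) ip_xi eta_phi mulr0; lra.
Qed.

Lemma ker_phi X : X *m P = 0 -> X = ev X w *: x.
Proof.
move=> XP; have := cp_square H X; rewrite XP mul0mx => E.
by apply: (addrI (- X)); rewrite -E addNr.
Qed.

Variable V : 'rV[R]_3.
Hypotheses (V0 : V != 0) (VV : ip G V V = 0).
Variables a b : R.
Hypotheses (Va : ev V w = a) (Vb : ip G V (V *m P) = b).

Lemma ip_phi_null : ip G (V *m P) (V *m P) = a ^+ 2.
Proof. by rewrite (cp_compat H) VV oppr0 add0r Va. Qed.

(** The number [a^4 + b^2] is, up to sign, the Gram determinant of
    [V], [xi], [phi V].  If it vanished, [V] would be orthogonal to these three
    vectors, which are independent when [a = 0] because [phi^2 V = - V]. *)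
Lemma null_gt0 : 0 < a ^+ 4 + b ^+ 2.
Proof.
have ge0 : 0 <= a ^+ 4 + b ^+ 2.
  by apply: addr_ge0; [exact: (exprn_even_ge0 a (n:=4))|exact: sqr_ge0].
rewrite lt0r ge0 andbT; apply: contra V0 => /eqP ab0; apply/eqP.
have a4 : 0 <= a ^+ 4 := exprn_even_ge0 a (n:=4) isT.
have b2 := sqr_ge0 b.
have /eqP : a ^+ 4 = 0 by lra.
rewrite expf_eq0 /= => /eqP a0.
have /eqP : b ^+ 2 = 0 by lra.
rewrite expf_eq0 /= => /eqP b0.
have uF : frame_mx V x (V *m P) \in unitmx.
  apply: frame_unit => p q r E.
  have q0 : q = 0.
    have := congr1 (fun z => ev z w) E; rewrite !evD !evZ (cp_eta_xi H) eta_phi Va a0.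
    by rewrite [RHS]/ev mul0mx mxE; lra.
  rewrite q0 scale0r addr0 in E.
  have E2 := congr1 (mulmx^~ P) E.
  rewrite mul0mx mulmxDl -!scalemxAl (cp_square H) Va a0 scale0r addr0 in E2.
  have : (p ^+ 2 + r ^+ 2) *: V = 0.
    have -> : (p ^+ 2 + r ^+ 2) *: V =
       p *: (p *: V + r *: (V *m P)) - r *: (p *: (V *m P) + r *: - V).
      by apply/rowP => j; rewrite !mxE; ring.
    by rewrite E E2 !scaler0 subr0.
  move/eqP; rewrite scaler_eq0 (negbTE V0) orbF => /eqP pr.
  have p2 := sqr_ge0 p; have r2 := sqr_ge0 r.
  have /eqP : p ^+ 2 = 0 by lra.
  have /eqP : r ^+ 2 = 0 by lra.
  by rewrite !expf_eq0 => /eqP -> /eqP ->.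
by apply: (ortho_frame (cp_unit H) uF); rewrite ?VV ?ip_xi ?Va ?Vb.
Qed.

(** The combinations below solve the linear system given by the Gram matrix
    of the three vectors, whose determinant is [- (a^4 + b^2)]. *)
Lemma null_basis : frame_mx V x (V *m P) \in unitmx.
Proof.
apply: frame_unit => p q r E; have D0 := null_gt0.
have EV : ip G (p *: V + q *: x + r *: (V *m P)) V = 0 by rewrite E ip0l.
have EX : ip G (p *: V + q *: x + r *: (V *m P)) x = 0 by rewrite E ip0l.
have EP : ip G (p *: V + q *: x + r *: (V *m P)) (V *m P) = 0 by rewrite E ip0l.
rewrite !ip_linear VV (ipC x _ (cp_sym H)) ip_xi ip_phi Va Vb in EV.
rewrite !ip_linear !ip_xi (cp_eta_xi H) eta_phi Va in EX.
rewrite !ip_linear (ipC x _ (cp_sym H)) ip_xi eta_phi ip_phi_null Vb in EP.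
have q_ : q = - (p * a) by lra.
have p0 : p * (a ^+ 4 + b ^+ 2) = 0.
  have -> : p * (a ^+ 4 + b ^+ 2) = b * (p * b + q * 0 + r * a ^+ 2)
    - a ^+ 2 * (p * 0 + q * a + r * b) + a ^+ 3 * (p * a + q * 1 + r * 0) by ring.
  by rewrite EV EX EP; ring.
move/eqP: p0; rewrite mulf_eq0 (gt_eqF D0) orbF => /eqP p0.
have q0 : q = 0 by rewrite q_ p0; ring.
split=> //; have r0 : r * (a ^+ 4 + b ^+ 2) = 0.
  have -> : r * (a ^+ 4 + b ^+ 2) = a ^+ 2 * (p * b + q * 0 + r * a ^+ 2)
    + b * (p * 0 + q * a + r * b) by rewrite p0 q0; ring.
  by rewrite EV EP; ring.
by move/eqP: r0; rewrite mulf_eq0 (gt_eqF D0) orbF => /eqP.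
Qed.

Hypothesis a0 : a != 0.
Let s := Num.sqrt (a ^+ 4 + b ^+ 2).

Let s0 : s != 0. Proof. by rewrite gt_eqF // sqrtr_gt0 null_gt0. Qed.
Let s2 : s ^+ 2 = a ^+ 4 + b ^+ 2.
Proof. by rewrite sqr_sqrtr // ltW // null_gt0. Qed.

Lemma slant_null_frame :
  null_frame G V (slant_normal a x V) (slant_binormal a b x V (V *m P)).
Proof.
have sG := cp_sym H.
have xx : ip G x x = 1 by rewrite ip_xi (cp_eta_xi H).
have Vx : ip G V x = a by rewrite ip_xi.
have xV : ip G x V = a by rewrite ipC.
have xP : ip G x (V *m P) = 0 by rewrite ipC // ip_xi eta_phi.
have Px : ip G (V *m P) x = 0 by rewrite ip_xi eta_phi.
have PV : ip G (V *m P) V = b by rewrite ip_phi.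
have PP := ip_phi_null.
have vals := (xx, Vx, xV, xP, Px, PV, PP, Vb, VV).
rewrite /slant_normal /slant_binormal; split; rewrite /= -/s !ip_linear !vals.
- by field; rewrite a0.
(* The product of the binormal with itself is [(a^4 + b^2) / s^2]. *)
- apply/eqP; rewrite -(inj_eq (mulfI (expf_neq0 2 s0))) mulr1 {2}s2; apply/eqP.
  by field; rewrite s0 a0.
- by field; rewrite a0.
- by field; rewrite a0 s0.
- by field; rewrite a0 s0.
Qed.

(** The change of basis is lower triangular with diagonal
    [1, 1 / a, a / sqrt (a^4 + b^2)], so the signs of [a] cancel. *)
Lemma slant_frame_oriented :
  exists Q, frame_mx V (slant_normal a x V) (slant_binormal a b x V (V *m P)) =
            Q *m frame_mx V x (V *m P) /\ 0 < \det Q.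
Proof.
pose al := - (b / s).
exists (frame_mx (row3 1 0 0) (row3 (- (2 * a ^+ 2)^-1) a^-1 0)
  (row3 (- (al / a)) al (a / s))).
split; last first.
  rewrite det_frame_row3 mulrA mulVf // mul1r invr_gt0 sqrtr_gt0; exact: null_gt0.
rewrite frame_mul !row3_frame /slant_binormal /= -/s -/al.
by congr frame_mx; apply/rowP => j; rewrite !mxE; ring.
Qed.

End ContactPoint.
End Pointwise.

(** * Calculus along a curve *)

Section AlongCurve.
Context {R : realType} {M : topologicalType} {A : atlas R M}.
Variables (S : almost_contact_Bmetric A) (nabla : chart_index A -> 'I_3 -> M -> 'M[R]_3).
Variables (J : set R) (C : R -> M).
Hypothesis J_open : open J.
Hypothesis C_smooth : smooth_curve (A:=A) J C.
Notation td := times_differentiable.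

Lemma contact_at (i : chart_index A) p : dom i p ->
  contact_point (phi S i p) (xi S i p) (Defs.eta S i p) (g S i p).
Proof.
move=> ip; have [_ _ gs gu] := g_metric S.
by split=> *; [exact: phi_square|exact: eta_xi|exact: g_phi|exact: gs|exact: gu].
Qed.

Lemma curve_dom_open (i : chart_index A) : open (curve_dom J C i).
Proof.
rewrite openE => t [Jt it]; apply: filterI; first exact: open_nbhs_nbhs.
by apply: (C_smooth.1 t Jt); apply: open_nbhs_nbhs; split=> //; exact: dom_open.
Qed.

Lemma chart_curve_codom (i : chart_index A) t : curve_dom J C i t ->
  (chart i @` dom i) ((chart i \o C) t).
Proof. by case=> _ it; exists (C t). Qed.

Lemma curve_differentiable (i : chart_index A) t : curve_dom J C i t ->
  differentiable (chart i \o C) t.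
Proof. by move=> it; exact: (C_smooth.2 i 1%N).1. Qed.

Lemma smooth_along m n (i : chart_index A) (f : M -> 'M[R]_(m, n)) :
  smooth_in i f -> smooth_on (curve_dom J C i) (f \o C).
Proof.
move=> sf k; have oD := @curve_dom_open i.
apply: (@td_ext _ _ _ _ _ ((f \o param i) \o (chart i \o C))) => //.
  by move=> t [_ it] /=; rewrite chartK.
by apply: td_comp (sf k) => //; [exact: chart_curve_codom|exact: C_smooth.2].
Qed.

Lemma derive_along m n (i : chart_index A) (f : M -> 'M[R]_(m, n)) t :
  smooth_in i f -> curve_dom J C i t ->
  'D_1 (f \o C) t = \sum_(k < 3) velocity C i t 0 k *: pd i k f (C t).
Proof.
move=> sf it; rewrite /velocity derive1E /pd.
have df : differentiable (f \o param i) ((chart i \o C) t).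
  exact: (sf 1%N).1 (chart_curve_codom it).
rewrite -(derive_comp_rV (1 : R) (curve_differentiable it) df).2.
apply: near_eq_derive; apply: filterS (open_nbhs_nbhs (conj (@curve_dom_open i) it)).
by move=> s [_ /= is_]; rewrite chartK.
Qed.

Lemma smooth_velocity (i : chart_index A) : smooth_on (curve_dom J C i) (velocity C i).
Proof.
move=> k; apply: td_ext ((C_smooth.2 i k.+1).2 (1 : R)); first exact: curve_dom_open.
by move=> t _; rewrite /velocity derive1E.
Qed.

(** The velocity is a vector field along the curve: this is the chain rule
    for the transition map of two charts. *)
Lemma velocity_jac (i j : chart_index A) t : curve_dom J C i t -> curve_dom J C j t ->
  velocity C j t = velocity C i t *m jac i j (C t).
Proof.
move=> it jt; rewrite /velocity !derive1E /jac.
have dij : differentiable (chart j \o param i) ((chart i \o C) t).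
  apply: (transition_smooth i j 1%N).1; exists (C t) => //.
  by split; [exact: it.2|exact: jt.2].
rewrite -(deriveEjacobian _ dij).
have dc := curve_differentiable it.
transitivity ('D_1 ((chart j \o param i) \o (chart i \o C)) t).
  apply: near_eq_derive; apply: filterS (open_nbhs_nbhs (conj (@curve_dom_open i) it)).
  by move=> s [_ /= is_]; rewrite chartK.
rewrite (deriveE _ (differentiable_comp dc dij)) diff_comp //=.
by rewrite (deriveE _ dij) (deriveE _ dc).
Qed.

Lemma ip_jac (i j : chart_index A) p X Y : dom i p -> dom j p ->
  ip (g S i p) X Y = ip (g S j p) (X *m jac i j p) (Y *m jac i j p).
Proof.
move=> pi pj; have [_ gt _ _] := g_metric S.
by rewrite /ip (gt i j p pi pj) trmx_mul !mulmxA.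
Qed.

(** The matrix of the connection along the curve, that is the Christoffel
    symbols contracted with the velocity. *)
Definition conn (i : chart_index A) t : 'M[R]_3 :=
  \sum_(k < 3) velocity C i t 0 k *: nabla i k (C t).

Lemma cov_derivE X (i : chart_index A) t :
  cov_deriv nabla C X i t = 'D_1 (X i) t + X i t *m conn i t.
Proof. by rewrite /cov_deriv derive1E. Qed.

Hypothesis LC : levi_civita (g S) nabla.

Lemma derive_metric_along (i : chart_index A) t : curve_dom J C i t ->
  'D_1 (g S i \o C) t = conn i t *m g S i (C t) + g S i (C t) *m (conn i t)^T.
Proof.
move=> it; have [sg _ _ _] := g_metric S; have [_ _ mc] := LC.
rewrite (derive_along (sg i) it) /conn mulmx_suml linear_sum mulmx_sumr -big_split.
apply: eq_bigr => k _ /=.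
by rewrite (mc _ _ it.2) scalerDr scalemxAl linearZ scalemxAr.
Qed.

(** Metric compatibility along the curve, in the only form used: two fields
    with constant product.  Differentiating [X g Y^T], the derivative of [g]
    supplies exactly the two connection terms. *)
Lemma leibniz (X Y : chart_index A -> R -> 'rV[R]_3) (i : chart_index A) t (c : R) :
  curve_dom J C i t ->
  differentiable (X i) t -> differentiable (Y i) t ->
  (forall s, curve_dom J C i s -> ip (g S i (C s)) (X i s) (Y i s) = c) ->
  ip (g S i (C t)) (cov_deriv nabla C X i t) (Y i t) +
  ip (g S i (C t)) (X i t) (cov_deriv nabla C Y i t) = 0.
Proof.
move=> it dX dY XYc; have [sg _ _ _] := g_metric S.
have dg : differentiable (g S i \o C) t := (smooth_along (sg i) 1%N).1 t it.
have [dXg DXg] := derive_mulmx (1 : R) dX dg.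
have [dYT DYT] := derive_trmx (1 : R) dY.
have [dXY DXY] := derive_mulmx (1 : R) dXg dYT.
have D0 : ('D_1 (fun s => X i s *m (g S i \o C) s *m (Y i s)^T) t) 0 0 = 0.
  rewrite derive_entry // (@near_eq_derive _ _ _ _ (cst c)) ?derive_cst //.
  by apply: filterS (open_nbhs_nbhs (conj (@curve_dom_open i) it)) => s /XYc.
rewrite DXY DXg DYT derive_metric_along //= in D0.
rewrite !cov_derivE /ip -D0.
rewrite linearD /= trmx_mul !mulmxDl !mulmxDr !mulmxDl !mulmxA !mxE; ring.
Qed.

Hypothesis F1 : F1_manifold S nabla.

Lemma nabla_phi_along (i : chart_index A) t : curve_dom J C i t ->
  nabla_phi S nabla i (C t) (velocity C i t) =
  'D_1 (phi S i \o C) t + phi S i (C t) *m conn i t - conn i t *m phi S i (C t).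
Proof.
move=> it; have [sp _] := phi_endo S.
rewrite /nabla_phi (derive_along (sp i) it) /conn mulmx_suml mulmx_sumr.
rewrite -big_split -sumrB /=.
by apply: eq_bigr => k _; rewrite scalerBr scalerDr -scalemxAl -scalemxAr.
Qed.

Hypothesis C_null : forall (i : chart_index A) t, curve_dom J C i t ->
  velocity C i t != 0 /\ ip (g S i (C t)) (velocity C i t) (velocity C i t) = 0.

(** In the defining identity of the class F1 with [xi] as second argument,
    each of the four products contains a factor [phi xi = 0] or the value of
    the Lee form at [0].  The identity speaks of a basis adapted to [ker eta];
    [V - eta(V) xi] and [phi V] provide one. *)
Lemma nabla_phi_xi (i : chart_index A) t : curve_dom J C i t ->
  xi S i (C t) *m nabla_phi S nabla i (C t) (velocity C i t) = 0.
Proof.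
move=> it; have H := contact_at it.2; have [V0 VV] := C_null it.
set V := velocity C i t in V0 VV *; set p := C t in H VV *.
pose e (k : 'I_2) :=
  if k == 0 then V - ev V (Defs.eta S i p) *: xi S i p else V *m phi S i p.
have basis : adapted_basis S i p e.
  split=> [k|].
    rewrite /e; case: ifP => _; last exact: eta_phi H _.
    by rewrite evD evN evZ (cp_eta_xi H); ring.
  apply: frame_unit => x y z E.
  have : row3 x (z - x * ev V (Defs.eta S i p)) y *m
         frame_mx V (xi S i p) (V *m phi S i p) = 0.
    by rewrite row3_frame -E /e /=; apply/rowP => l; rewrite !mxE; ring.
  move=> /(congr1 (mulmx^~ (invmx (frame_mx V (xi S i p) (V *m phi S i p))))).
  rewrite mulmxK ?mul0mx; last by have := null_basis H V0 VV erefl erefl.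
  move=> /rowP r0; move: (r0 0) (r0 1) (r0 2%:R); rewrite !mxE /= => -> + ->.
  by rewrite mul0r subr0 => ->.
have th0 : lee_form S nabla i p e 0 = 0.
  rewrite /lee_form big1 // => k _; rewrite big1 // => l _.
  by rewrite /fundamental_tensor ip0r mulr0.
apply: (ip_nondegenerate (cp_unit H)) => Z.
have := F1 it.2 basis V (xi S i p) Z.
by rewrite /fundamental_tensor /= (phi_xi H) !mul0mx !ip0r th0 !mulr0 !mul0r !addr0 mulr0.
Qed.

(** Differentiating [phi xi = 0] gives
    [phi (nabla xi) = - (nabla phi) xi = 0], so [nabla xi] is a multiple of
    [xi]; it is also orthogonal to [xi] because [g (xi, xi) = 1]. *)
Lemma xi_parallel (i : chart_index A) t : curve_dom J C i t ->
  cov_deriv nabla C (fun i t => xi S i (C t)) i t = 0.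
Proof.
move=> it; have H := contact_at it.2.
have [sx _] := xi_vector S; have [sp _] := phi_endo S.
have dx : differentiable (xi S i \o C) t := (smooth_along (sx i) 1%N).1 t it.
have dp : differentiable (phi S i \o C) t := (smooth_along (sp i) 1%N).1 t it.
set D := cov_deriv _ _ _ _ _.
have DP : D *m phi S i (C t) = 0.
  have [_] := derive_mulmx (1 : R) dx dp.
  rewrite (@near_eq_derive _ _ _ _ (cst 0)); last first.
    apply: filterS (open_nbhs_nbhs (conj (@curve_dom_open i) it)) => s is_.
    exact: phi_xi (contact_at is_.2).
  rewrite derive_cst => E0.
  have := nabla_phi_xi it; rewrite nabla_phi_along // mulmxBr mulmxDr mulmxA.
  rewrite (phi_xi H) mul0mx addr0.
  move/eqP; rewrite subr_eq0 => /eqP E1.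
  by rewrite /D cov_derivE mulmxDl -mulmxA -E1 -E0.
have := @leibniz (fun i t => xi S i (C t)) (fun i t => xi S i (C t)) i t 1 it dx dx.
rewrite -/D (ipC _ D (cp_sym H)) (ip_xi H) => E.
rewrite (ker_phi H DP).
have -> : ev D (Defs.eta S i (C t)) = 0; last by rewrite scale0r.
apply: addrr0_eq0; apply: E => s is_.
by rewrite (ip_xi (contact_at is_.2)) (cp_eta_xi (contact_at is_.2)).
Qed.

End AlongCurve.

(** * Slant null curves *)

Section SlantNullCurve.
Context {R : realType} {M : topologicalType} {A : atlas R M}.
Variables (S : almost_contact_Bmetric A) (nabla : chart_index A -> 'I_3 -> M -> 'M[R]_3).
Variables (J : set R) (C : R -> M).
Hypothesis J_open : open J.
Hypothesis C_null : null_curve S J C.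
Hypothesis LC : levi_civita (g S) nabla.
Hypothesis F1 : F1_manifold S nabla.
Variables (a : R) (b : R -> R).
Hypothesis C_slant : slant S J C a.
Hypothesis b_def : forall (i : chart_index A) t, curve_dom J C i t ->
  b t = ip (g S i (C t)) (velocity C i t) (velocity C i t *m phi S i (C t)).
Notation td := times_differentiable.
Let C_smooth : smooth_curve (A:=A) J C := C_null.1.

Definition curve_normal (i : chart_index A) t :=
  slant_normal a (xi S i (C t)) (velocity C i t).
Definition curve_binormal (i : chart_index A) t :=
  slant_binormal a (b t) (xi S i (C t)) (velocity C i t) (velocity C i t *m phi S i (C t)).

Let acc := cov_deriv nabla C (fun i : chart_index A => velocity C i).

Lemma velocity_differentiable (i : chart_index A) t : curve_dom J C i t ->
  differentiable (velocity C i) t.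
Proof. by move=> it; exact: ((smooth_velocity J_open C_smooth i) 1%N).1. Qed.

Lemma xi_differentiable (i : chart_index A) t : curve_dom J C i t ->
  differentiable (fun s => xi S i (C s)) t.
Proof.
move=> it; have [sx _] := xi_vector S.
exact: (smooth_along J_open C_smooth (sx i) 1%N).1 t it.
Qed.

Lemma acc_velocity (i : chart_index A) t : curve_dom J C i t ->
  ip (g S i (C t)) (acc i t) (velocity C i t) = 0.
Proof.
move=> it; have H := contact_at S it.2; have dV := velocity_differentiable it.
have := leibniz J_open C_smooth LC (X:=velocity C (A:=A)) (Y:=velocity C (A:=A)) (c:=0)
  it dV dV.
rewrite (ipC (velocity _ _ _) _ (cp_sym H)) => E.
by apply: addrr0_eq0; apply: E => s is_; have [] := C_null.2 i s is_.
Qed.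

Lemma acc_xi (i : chart_index A) t : curve_dom J C i t ->
  ip (g S i (C t)) (acc i t) (xi S i (C t)) = 0.
Proof.
move=> it; have dV := velocity_differentiable it.
have := leibniz J_open C_smooth LC (X:=velocity C (A:=A))
  (Y:=fun i t => xi S i (C t)) (c:=a) it dV (xi_differentiable it).
rewrite (xi_parallel J_open C_smooth LC F1 C_null.2 it) ip0r addr0; apply=> s is_.
by rewrite (ip_xi (contact_at S is_.2)); exact: C_slant.
Qed.

(** As [xi] is parallel, [nabla V = h V + k1 W] is orthogonal to [xi].  If [a]
    were [0], then [k1 != 0] would make [W], as well as [V], orthogonal to [xi];
    the unit vector [xi] would be a multiple of the null vector [V]. *)
Lemma slant_const_neq0 (C_ng : non_geodesic S nabla J C) t : J t -> a != 0.
Proof.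
move=> Jt; have [i it0] := dom_cover A (C t).
have it : curve_dom J C i t by [].
have H := contact_at S it.2; have [N [W [h [k1 [k2 [Fr Eq k10]]]]]] := C_ng.
have [_ _ /(_ i t it)[_ [VN WW NN NW VW]]] := Fr.
have [EV _ _] := Eq i t it.
have := acc_xi it; rewrite /acc EV !ip_linear !(ip_xi H) C_slant // => Exi.
apply/eqP => a0; move: Exi; rewrite a0 mulr0 add0r => /eqP.
rewrite mulf_eq0 (negbTE (k10 t Jt)) /= => /eqP eW.
have sG := cp_sym H.
have [_ VV] := C_null.2 i t it.
have xV : ip (g S i (C t)) (xi S i (C t)) (velocity C i t) = 0.
  by rewrite ipC // (ip_xi H) C_slant.
have xW : ip (g S i (C t)) (xi S i (C t)) (W i t) = 0 by rewrite ipC // (ip_xi H).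
have x_eq := null_frame_expand (xi S i (C t)) sG (cp_unit H) VV (And5 VN WW NN NW VW).
rewrite xV xW !scale0r !addr0 in x_eq.
have := cp_eta_xi H; rewrite x_eq evZ C_slant // a0 mulr0 => /esym/eqP.
by rewrite oner_eq0.
Qed.

Hypothesis a0 : a != 0.

Lemma b_smooth (i : chart_index A) k : td k (curve_dom J C i) b.
Proof.
have oD := curve_dom_open J_open C_smooth (i:=i).
have [sp _] := phi_endo S; have [sg _ _ _] := g_metric S.
have sV := smooth_velocity J_open C_smooth i k.
apply: (@td_ext _ _ _ _ _ (fun t => (velocity C i t *m g S i (C t) *m
   (velocity C i t *m phi S i (C t))^T) 0 0)) => //.
  by move=> t it; rewrite (b_def it).
apply: ((td_mxP _ _ oD).1 _ 0 0).
apply: (td_mulmx oD).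
  by apply: (td_mulmx oD) => //; exact (smooth_along J_open C_smooth (sg i) k).
apply: td_trmx => //; apply: td_mulmx => //.
exact (smooth_along J_open C_smooth (sp i) k).
Qed.

Lemma inv_sqrt_smooth (i : chart_index A) k :
  td k (curve_dom J C i) (fun t => (Num.sqrt (a ^+ 4 + b t ^+ 2))^-1).
Proof.
have oD := curve_dom_open J_open C_smooth (i:=i).
apply: td_inv_sqrt => //.
  move=> t it; have [V0 VV] := C_null.2 i t it.
  exact (null_gt0 (contact_at S it.2) V0 VV (C_slant it) (esym (b_def it))).
apply: td_add => //; first exact: td_cst.
by apply: td_mul => //; exact: b_smooth.
Qed.

Lemma normal_field : field_along J C curve_normal.
Proof.
have [sx tx] := xi_vector S.
split=> [i k|i j t it jt]; last first.
  rewrite /curve_normal /slant_normal (tx i j _ it.2 jt.2).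
  rewrite (velocity_jac J_open C_smooth it jt).
  by rewrite mulmxBl -!scalemxAl.
have oD := curve_dom_open J_open C_smooth (i:=i).
apply: (@td_ext _ _ _ _ _ (fun t =>
  a^-1 *: xi S i (C t) + (- (2 * a ^+ 2)^-1) *: velocity C i t)) => //.
  by move=> t _; rewrite scaleNr.
apply: td_add => //; apply: td_scale => //; try exact: td_cst.
  exact (smooth_along J_open C_smooth (sx i) k).
exact: smooth_velocity.
Qed.

Lemma binormal_field : field_along J C curve_binormal.
Proof.
have [sx tx] := xi_vector S; have [sp tp] := phi_endo S.
split=> [i k|i j t it jt]; last first.
  rewrite /curve_binormal /slant_binormal /= (tx i j _ it.2 jt.2).
  rewrite (velocity_jac J_open C_smooth it jt).
  by rewrite mulmxDl mulmxBl -!scalemxAl -!mulmxA (tp i j _ it.2 jt.2).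
have oD := curve_dom_open J_open C_smooth (i:=i).
have sr := inv_sqrt_smooth i k; have sb := b_smooth i k.
have sV := smooth_velocity J_open C_smooth i k.
pose r t := (Num.sqrt (a ^+ 4 + b t ^+ 2))^-1.
apply: (@td_ext _ _ _ _ _ (fun t => ((-1 * (b t * r t)) *: xi S i (C t) +
   (a^-1 * (b t * r t)) *: velocity C i t) +
   (a * r t) *: (velocity C i t *m phi S i (C t)))) => //.
  move=> t _; rewrite /curve_binormal /slant_binormal /= -/(r t).
  rewrite -[- (_ *: velocity _ _ _)]scaleNr.
  by congr (_ *: _ + _ *: _ + _); rewrite /r; ring.
have sbr : td k (curve_dom J C i) (fun t => b t * r t) by exact: td_mul.
apply: td_add => //; first (apply: td_add => //); apply: td_scale => //.
- by apply: td_mul => //; exact: td_cst.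
- exact (smooth_along J_open C_smooth (sx i) k).
- by apply: td_mul => //; exact: td_cst.
- by apply: td_mul => //; exact: td_cst.
- by apply: td_mulmx => //; exact (smooth_along J_open C_smooth (sp i) k).
Qed.

Lemma curve_null_frame (i : chart_index A) t : curve_dom J C i t ->
  null_frame (g S i (C t)) (velocity C i t) (curve_normal i t) (curve_binormal i t).
Proof.
move=> it; have [V0 VV] := C_null.2 i t it.
exact (slant_null_frame (contact_at S it.2) V0 VV (C_slant it) (esym (b_def it)) a0).
Qed.

Lemma curve_frenet : general_frenet_frame S J C curve_normal curve_binormal.
Proof.
split; [exact: normal_field|exact: binormal_field|].
move=> i t it /=; have F := curve_null_frame it; have H := contact_at S it.2.
have [_ VV] := C_null.2 i t it.
by split; [exact: null_frame_unit (cp_sym H) VV F|exact: F].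
Qed.

Lemma curve_oriented : xi_oriented S J C curve_normal curve_binormal.
Proof.
move=> i t it; have [V0 VV] := C_null.2 i t it.
exact (slant_frame_oriented (contact_at S it.2) V0 VV (C_slant it) (esym (b_def it)) a0).
Qed.

(** The acceleration is orthogonal to [V] (which is null) and to [xi] (the
    curve is slant and [xi] parallel), hence also to [N1], a combination of
    the two.  This is the vanishing of the function [h]. *)
Lemma acc_binormal (i : chart_index A) t : curve_dom J C i t ->
  acc i t = ip (g S i (C t)) (acc i t) (curve_binormal i t) *: curve_binormal i t.
Proof.
move=> it; have F := curve_null_frame it; have H := contact_at S it.2.
have [_ VV] := C_null.2 i t it.
move: (acc i t) (acc_xi it) (acc_velocity it) => D Dx DV.
have DN : ip (g S i (C t)) D (curve_normal i t) = 0.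
  by rewrite /curve_normal /slant_normal !ip_linear Dx DV !mulr0 subr0.
by rewrite [LHS](null_frame_expand _ (cp_sym H) (cp_unit H) VV F) DV DN !scale0r !add0r.
Qed.

Lemma cov_normal (i : chart_index A) t : curve_dom J C i t ->
  cov_deriv nabla C curve_normal i t = - (2 * a ^+ 2)^-1 *: acc i t.
Proof.
move=> it; have X0 := xi_parallel J_open C_smooth LC F1 C_null.2 it.
have dV := velocity_differentiable it; have dX := xi_differentiable it.
rewrite /acc !cov_derivE in X0 *.
have -> : 'D_1 (curve_normal i) t =
    a^-1 *: 'D_1 (fun s => xi S i (C s)) t - (2 * a ^+ 2)^-1 *: 'D_1 (velocity C i) t.
  have dX1 : derivable (fun s => xi S i (C s)) t 1 := diff_derivable dX.
  have dV1 : derivable (velocity C i) t 1 := diff_derivable dV.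
  have -> : curve_normal i =
      (a^-1 \*: (fun s => xi S i (C s))) - ((2 * a ^+ 2)^-1 \*: velocity C i) by [].
  by rewrite (deriveB (derivableZ dX1) (derivableZ dV1)) (deriveZ _ dX1) (deriveZ _ dV1).
move: X0; set D := 'D_1 _ t; set D' := 'D_1 _ t => X0.
rewrite /curve_normal /slant_normal mulmxBl -!scalemxAl.
have -> : D = - (xi S i (C t) *m conn nabla C i t) by apply/eqP; rewrite -addr_eq0 X0.
by rewrite scalerN scaleNr scalerDr opprD addrACA addNr add0r.
Qed.

(** Once [nabla V = k1 W1] is known, [N1] being a combination of [V] and of the
    parallel field [xi] gives [k2 = - k1 / (2 a^2)], and the equation for [W1]
    follows by differentiating the constant products with [W1]. *)
Lemma curve_frenet_equations (k1 : R -> R) :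
  (forall (i : chart_index A) t, curve_dom J C i t ->
     ip (g S i (C t)) (acc i t) (curve_binormal i t) = k1 t) ->
  frenet_equations nabla J C curve_normal curve_binormal
    (fun=> 0) k1 (fun t => - (2 * a ^+ 2)^-1 * k1 t).
Proof.
move=> k1E i t it; have H := contact_at S it.2; have [_ VV] := C_null.2 i t it.
have sG := cp_sym H; have F := curve_null_frame it.
have AW : acc i t = k1 t *: curve_binormal i t by rewrite acc_binormal // k1E.
have NW : cov_deriv nabla C curve_normal i t =
    (- (2 * a ^+ 2)^-1 * k1 t) *: curve_binormal i t.
  by rewrite cov_normal // AW scalerA.
have dV := velocity_differentiable it.
have dN : differentiable (curve_normal i) t := (normal_field.1 i 1%N).1 t it.
have dW : differentiable (curve_binormal i) t := (binormal_field.1 i 1%N).1 t it.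
have LWW := leibniz J_open C_smooth LC (X:=curve_binormal) (Y:=curve_binormal) (c:=1)
  it dW dW.
have LVW := leibniz J_open C_smooth LC (X:=velocity C (A:=A)) (Y:=curve_binormal) (c:=0)
  it dV dW.
have LNW := leibniz J_open C_smooth LC (X:=curve_normal) (Y:=curve_binormal) (c:=0)
  it dN dW.
rewrite -/(acc i t) AW in LVW; rewrite NW in LNW.
move: LWW LVW LNW; move: (cov_deriv nabla C curve_binormal i t) => D LWW LVW LNW.
case: (F) => F1' F2 F3 F4 F5.
rewrite !(ipC _ D sG) in LWW LVW LNW.
rewrite ipZl F2 mulr1 in LVW.
rewrite ipZl F2 mulr1 in LNW.
have DW : ip (g S i (C t)) D (curve_binormal i t) = 0.
  by apply: addrr0_eq0; apply: LWW => s is_; have [] := curve_null_frame is_.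
have DV : ip (g S i (C t)) D (velocity C i t) = - k1 t.
  apply/eqP; rewrite -addr_eq0 addrC LVW // => s is_.
  by have [] := curve_null_frame is_.
have DN : ip (g S i (C t)) D (curve_normal i t) = - (- (2 * a ^+ 2)^-1 * k1 t).
  apply/eqP; rewrite -addr_eq0 addrC LNW // => s is_.
  by have [] := curve_null_frame is_.
split.
- by rewrite scale0r add0r.
- by rewrite oppr0 scale0r add0r.
- rewrite [LHS](null_frame_expand D sG (cp_unit H) VV F) DW DV DN.
  by rewrite scale0r addr0 [(- k1 t) *: _]scaleNr.
Qed.

(** The Frenet functions must not depend on the chart.  The curve being
    non-geodesic provides some frame [N], [W] with [nabla V = h V + k1 W], so
    the product of [nabla V] with [W1] is [k1 g (W, W1)], and [g (W, W1)] is the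
    same in all charts; [ch t] picks one of them at [C t]. *)
Lemma curve_distinguished (C_ng : non_geodesic S nabla J C) :
  distinguished nabla J C curve_normal curve_binormal.
Proof.
have [N [W [h [k1 [k2 [Fr Eq k10]]]]]] := C_ng.
pose ch t : chart_index A := projT1 (cid (dom_cover A (C t))).
pose q i t := ip (g S i (C t)) (W i t) (curve_binormal i t).
exists (fun=> 0), (fun t => k1 t * q (ch t) t).
exists (fun t => - (2 * a ^+ 2)^-1 * (k1 t * q (ch t) t)).
split=> //; apply: curve_frenet_equations => i t it.
have jt : curve_dom J C (ch t) t by split; [exact: it.1|rewrite /ch /=; case: cid].
have [_ [_ tW] _] := Fr.
have [EV _ _] := Eq i t it; rewrite /acc EV ipDl !ipZl.
have [_ _ _ _ ->] := curve_null_frame it; rewrite mulr0 add0r /q.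
by rewrite (ip_jac S _ _ it.2 jt.2) -tW // -(binormal_field.2 _ _ _ it jt).
Qed.

(** In a distinguished frame the acceleration is a multiple of [W], so the unit
    vectors [W] and [W1] agree up to the sign [e]; the relations of a null frame
    then determine [N = N1], and the orientation excludes [e = - 1]. *)
Lemma frenet_unique (C_ng : non_geodesic S nabla J C) N W :
  general_frenet_frame S J C N W -> xi_oriented S J C N W ->
  distinguished nabla J C N W ->
  eq_along J C N curve_normal /\ eq_along J C W curve_binormal.
Proof.
move=> Fr Or [h [k1 [k2 [Eq h0]]]].
suff NW i t : curve_dom J C i t -> N i t = curve_normal i t /\ W i t = curve_binormal i t.
  by split=> i t it; have [] := NW i t it.
move=> it; have H := contact_at S it.2; have [V0 VV] := C_null.2 i t it.
have sG := cp_sym H; have F := curve_null_frame it.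
have [_ _ /(_ i t it)[_ F']] := Fr.
have [N' [W' [h' [k1' [k2' [Fr' Eq' k10]]]]]] := C_ng.
have [_ _ /(_ i t it)[_ [VN' WW' NN' NW' VW']]] := Fr'.
have [EV _ _] := Eq i t it; have [EV' _ _] := Eq' i t it.
rewrite h0 ?scale0r ?add0r in EV; last exact: it.1.
have AW := acc_binormal it; move: AW; set k := ip _ _ _ => AW.
have k_ne0 : k != 0.
  apply: contra (k10 t it.1) => /eqP k0.
  have := congr1 (ip (g S i (C t)) ^~ (W' i t)) AW.
  rewrite /acc EV' k0 scale0r !ip_linear VW' WW' mulr0 add0r mulr1 => ->; exact: eqxx.
have k1_ne0 : k1 t != 0.
  apply: contra k_ne0 => /eqP k0.
  have := congr1 (ip (g S i (C t)) ^~ (curve_binormal i t)) AW.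
  by case: F => _ F2 _ _ _; rewrite /acc EV k0 scale0r ip0l ipZl F2 mulr1 => <-.
pose e := k / k1 t.
have WE : W i t = e *: curve_binormal i t.
  by rewrite /e mulrC -scalerA -AW /acc EV scalerA mulVf ?scale1r.
have e2 : e ^+ 2 = 1.
  case: F F' => _ F2 _ _ _ [_ F2' _ _ _].
  by rewrite WE ipZl ipZr F2 mulr1 in F2'.
have NE : N i t = curve_normal i t.
  rewrite (null_frame_expand (N i t) sG (cp_unit H) VV F).
  case: F F' => F1' F2 F3 F4 F5 [G1 G2 G3 G4 G5].
  have NW0 : ip (g S i (C t)) (N i t) (curve_binormal i t) = 0.
    move: G4; rewrite WE ipZr => /eqP; rewrite mulf_eq0 => /orP[/eqP e0|/eqP //].
    by move: e2; rewrite e0 expr0n /= => /esym/eqP; rewrite oner_eq0.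
  have NV : ip (g S i (C t)) (N i t) (velocity C i t) = 1 by rewrite ipC.
  (* Pairing the expansion of [N] with [N] itself gives [0 = 2 g (N, N1)]. *)
  have := congr1 (fun X => ip (g S i (C t)) X (N i t))
    (null_frame_expand (N i t) sG (cp_unit H) VV (And5 F1' F2 F3 F4 F5)).
  rewrite !ipDl !ipZl G3 NW0 NV (ipC (curve_normal i t) _ sG) G1 => E.
  have -> : ip (g S i (C t)) (N i t) (curve_normal i t) = 0 by lra.
  by rewrite scale0r scale1r add0r scale0r addr0.
split=> //; rewrite WE.
have /eqP : (e - 1) * (e + 1) = 0 by rewrite -subr_sqr e2 expr1n subrr.
rewrite mulf_eq0 subr_eq0 addr_eq0 => /orP[/eqP -> |/eqP e1]; first by rewrite scale1r.
have [Q [QE Qpos]] := Or i t it; have [Q' [QE' Q'pos]] := curve_oriented it.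
(* Reversing [W1] multiplies the change of basis by [diag (1, 1, -1)]. *)
have QQ : Q = frame_mx (row3 1 0 0) (row3 0 1 0) (row3 0 0 (-1)) *m Q'.
  have uB := null_basis H V0 VV erefl erefl.
  apply: (can_inj (mulmxK uB)); rewrite -mulmxA -QE' -QE NE WE e1.
  rewrite frame_mul !row3_frame; congr frame_mx;
    by rewrite !(scale0r, scale1r, scaleN1r, addr0, add0r).
move: Qpos; rewrite QQ det_mulmx det_frame_row3 mul1r mulN1r oppr_gt0 => Q'neg.
by have := lt_trans Q'pos Q'neg; rewrite ltxx.
Qed.

End SlantNullCurve.

(** * The distinguished Frenet frame *)

Theorem theorem3p6 (R : realType) (M : topologicalType)
  (M_hausdorff : hausdorff_space M) (M_countable : @second_countable M)
  (A : atlas R M) (S : almost_contact_Bmetric A)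
  (nabla : chart_index A -> 'I_3 -> M -> 'M[R]_3)
  (nabla_LC : levi_civita (g S) nabla)
  (M_F1 : F1_manifold S nabla)
  (J : set R) (J_interval : open_interval J) (C : R -> M)
  (C_null : null_curve S J C) (C_non_geodesic : non_geodesic S nabla J C)
  (a : R) (C_slant : slant S J C a)
  (b : R -> R)
  (b_def : forall i t, curve_dom J C i t ->
     b t = ip (g S i (C t)) (velocity C i t) (velocity C i t *m phi S i (C t))) :
  let admissible N W :=
    [/\ general_frenet_frame S J C N W, xi_oriented S J C N W &
        distinguished nabla J C N W] in
  let alpha t := - (b t / Num.sqrt (a ^+ 4 + b t ^+ 2)) in
  let gamma t := a / Num.sqrt (a ^+ 4 + b t ^+ 2) in
  exists N1 W1 : chart_index A -> R -> 'rV[R]_3,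
    [/\ admissible N1 W1,
        forall N W, admissible N W ->
          eq_along J C N N1 /\ eq_along J C W W1 &
        forall i t, curve_dom J C i t ->
          W1 i t = alpha t *: xi S i (C t) - (alpha t / a) *: velocity C i t
                   + gamma t *: (velocity C i t *m phi S i (C t)) /\
          N1 i t = a^-1 *: xi S i (C t) - (2 * a ^+ 2)^-1 *: velocity C i t].
Proof.
move=> admissible alpha gamma; have [[t Jt] J_open _] := J_interval.
have a0 := slant_const_neq0 J_open C_null nabla_LC M_F1 C_slant C_non_geodesic Jt.
exists (curve_normal S C a), (curve_binormal S C a b); split.
- split.
  + exact (curve_frenet J_open C_null C_slant b_def a0).
  + exact (curve_oriented C_null C_slant b_def a0).
  + exact (curve_distinguished J_open C_null nabla_LC M_F1 C_slant b_def a0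
      C_non_geodesic).
- move=> N W [frenet oriented h0].
  exact (frenet_unique J_open C_null nabla_LC M_F1 C_slant b_def a0 C_non_geodesic
    frenet oriented h0).
- by [].
Qed.
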